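(* Let $a,c,n$ be integers with $c\ge 1$ odd, $n\ge 2$ and $1\le a\le 2^n$. Then $$\nu_2\big(S(c2^n,\,(c-1)2^n+a)\big)=s_2(a)-1.$$
   Context: $S(n,k)$ denotes the Stirling number of the second kind: the number of partitions of an $n$-element set into exactly $k$ nonempty subsets. $\nu_2(m)$ denotes the 2-adic valuation of $m$ (the exponent of the highest power of 2 dividing $m$). $s_2(m)$ denotes the sum of the binary digits of the nonnegative integer $m$. *)

(* Defs.v *)
From mathcomp Require Import all_boot.

Set Implicit Arguments.
Unset Strict Implicit.
Unset Printing Implicit Defensive.

(* Stirling number of the second kind. MathComp's [partition] already
   requires the blocks to be nonempty. *)
Definition stirling2 (n k : nat) : nat :=
  #|[set P : {set {set 'I_n}} | partition P [set: 'I_n] & #|P| == k]|.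

(* Sum of the binary digits of m; the range i < m reaches every nonzero digit
   because m < 2 ^ m. *)
Definition s2 (m : nat) : nat := \sum_(i < m) ((m %/ 2 ^ i) %% 2).

(* Main.v *)
(* From k! S(N, k) = N! [x^N] (e^x - 1)^k one gets
     2^N k! S(N, k) = 2^k N! [x^N] ((e^(2x) - 1) / 2)^k.
   The coefficient 2^(i-1) / i! of (e^(2x) - 1) / 2 has 2-adic valuation s2(i) - 1, so
   this series is 2-integral and reduces mod 2 to g = sum_j x^(2^j). By Legendre's
   formula v2(S(N, k)) >= s2(k) - s2(N), with equality iff [x^N] g^k is odd. Over F_2,
   g^2 = g + x, which forces [x^N] g^k = C(2N - k, N). In the theorem this binomial is
   C(c 2^n + m, m) with m = 2^n - a < 2^n: the addition has no binary carry, so it is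
   odd, and s2(k) - s2(N) = s2(a) - 1. *)

Require Import Defs.
From mathcomp Require Import all_boot.
From mathcomp Require Import all_algebra zify.

Set Implicit Arguments.
Unset Strict Implicit.
Unset Printing Implicit Defensive.

Import GRing.Theory.

(** * Binary digit sums and Legendre's formula at 2 *)

Lemma s2_widen m l : m <= l -> \sum_(i < l) ((m %/ 2 ^ i) %% 2) = s2 m.
Proof.
move=> le_ml; rewrite /s2 -!(big_mkord xpredT (fun i => (m %/ 2 ^ i) %% 2)).
rewrite (big_cat_nat (leq0n m) le_ml) /= [X in _ + X]big1_seq ?addn0 // => i.
rewrite mem_index_iota => /andP[_ /andP[le_mi _]].
by rewrite divn_small // (leq_ltn_trans le_mi) // ltn_expl.
Qed.

Lemma s2_half m : s2 m = odd m + s2 m./2.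
Proof.
rewrite -(s2_widen (leqnSn m)) big_ord_recl divn1 modn2; congr (_ + _).
rewrite -(@s2_widen m./2 m); last by lia.
by apply: eq_bigr => i _; rewrite /= expnS divnMA divn2.
Qed.

Lemma s2_eq0 m : (s2 m == 0) = (m == 0).
Proof.
elim/ltn_ind: m => -[|m] IH; first by rewrite /s2 big_ord0.
rewrite s2_half addn_eq0 IH; lia.
Qed.

Lemma s2_exp2 n : s2 (2 ^ n) = 1.
Proof.
elim: n => [|n IH]; first by rewrite /s2 big_ord_recl big_ord0.
by rewrite s2_half expnS mul2n odd_double doubleK IH.
Qed.

Lemma s2_shiftD c a n : a < 2 ^ n -> s2 (c * 2 ^ n + a) = s2 c + s2 a.
Proof.
elim: n a => [|n IH] a lt_a; first by rewrite [a](_ : a = 0) ?muln1 ?addn0 /s2 ?big_ord0; lia.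
rewrite s2_half [s2 a]s2_half addnCA -IH; last by rewrite expnS in lt_a; lia.
have -> : c * 2 ^ n.+1 + a = (c * 2 ^ n).*2 + a by rewrite expnS; lia.
by rewrite oddD odd_double; congr (_ + s2 _); lia.
Qed.

(** Legendre's formula, kept additive to avoid truncated subtraction. Each quotient [m %/ 2 ^ i] is
    twice the next one plus the digit at [i]; summing over [i] telescopes. *)
Lemma logn2_factD m : logn 2 m`! + s2 m = m.
Proof.
have -> : logn 2 m`! = \sum_(i < m) m %/ 2 ^ i.+1.
  by rewrite logn_fact // big_add1 big_mkord.
have shift : \sum_(i < m) m %/ 2 ^ i = m + \sum_(i < m) m %/ 2 ^ i.+1.
  have small : m %/ 2 ^ m = 0 by rewrite divn_small // ltn_expl.
  have -> : \sum_(i < m) m %/ 2 ^ i = \sum_(i < m.+1) m %/ 2 ^ i.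
    by rewrite big_ord_recr /= small addn0.
  by rewrite big_ord_recl divn1.
apply/eqP; rewrite -(eqn_add2l (\sum_(i < m) m %/ 2 ^ i.+1)) addnA.
rewrite [X in _ == X]addnC -shift -!big_split; apply/eqP/eq_bigr => i _ /=.
by rewrite expnSr divnMA [RHS](divn_eq _ 2); lia.
Qed.

(** * Set partitions and surjections *)

Section SetPartitions.

Variable T : finType.

Definition kpartitions (A : {set T}) k : {set {set {set T}}} :=
  [set P | partition P A & #|P| == k].

(* Double counting of the pairs of a partition and one of its blocks. *)
Lemma card_kpartitionsS (A : {set T}) k :
  k.+1 * #|kpartitions A k.+1| =
  \sum_(B : {set T} | (B \subset A) && (B != set0)) #|kpartitions (A :\: B) k|.
Proof.
have -> : k.+1 * #|kpartitions A k.+1| =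
    \sum_(P in kpartitions A k.+1) \sum_(B in P) 1.
  rewrite mulnC -sum_nat_const; apply: eq_bigr => P.
  by rewrite inE sum1_card => /andP[_ /eqP->].
rewrite (exchange_big_dep (fun B : {set T} => (B \subset A) && (B != set0))) /=; last first.
  move=> P B; rewrite inE => /andP[partP _] BP.
  by rewrite (partitionS partP BP) (partition_neq0 partP BP).
apply: eq_bigr => B /andP[sBA B_neq0]; rewrite sum1dep_card.
(* Deleting [B] is injective on the partitions that contain [B]. *)
rewrite -(@card_in_imset _ _ (fun P : {set {set T}} => P :\ B)); last first.
  move=> P Q; rewrite !inE => /andP[_ BP] /andP[_ BQ] eqPQ.
  by rewrite -(setD1K BP) eqPQ setD1K.
congr #|pred_of_set _|; apply/setP=> Q; apply/imsetP/idP.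
  case=> P; rewrite !inE => /andP[/andP[partP /eqP cardP] BP] ->.
  by rewrite partitionD1 //= -eqSS -[X in _ == X]cardP (cardsD1 B P) BP.
rewrite inE => /andP[partQ /eqP cardQ].
have BQ : B \notin Q.
  apply: contra B_neq0 => BQ; have := partitionS partQ BQ.
  by rewrite subsetD => /andP[_]; rewrite -setI_eq0 setIid.
exists (B |: Q); last by rewrite setU1K.
rewrite !inE eqxx /= cardsU1 BQ cardQ eqxx !andbT.
rewrite -[A](setID A B) (setIidPr sBA) partitionU1 //.
by rewrite disjoint_sym disjoints_subset subsetDr.
Qed.

End SetPartitions.

(* Surjections from n points onto k points; i is the size of the fibre of one of them. *)
Fixpoint surj (n k : nat) : nat :=
  if k is k'.+1 then \sum_(1 <= i < n.+1) 'C(n, i) * surj (n - i) k' else n == 0.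

Lemma card_kpartitions (T : finType) (A : {set T}) k :
  k`! * #|kpartitions A k| = surj #|A| k.
Proof.
elim: k A => [|k IH] A /=.
  rewrite mul1n cards_eq0; have [->|A_neq0] := eqVneq A set0.
    rewrite (_ : kpartitions _ _ = [set set0]) ?cards1 //.
    by apply/setP=> P; rewrite !inE partition_set0 cards_eq0 andbb.
  apply/eqP; rewrite cards_eq0; apply/eqP/setP=> P; rewrite !inE cards_eq0.
  apply: contraNF A_neq0 => /andP[partP /eqP P0].
  by rewrite -(cover_partition partP) P0 /cover big_set0.
rewrite factS mulnAC card_kpartitionsS big_distrl /=.
under eq_bigr => B /andP[sBA _] do rewrite mulnC IH cardsDS //.
rewrite (partition_big (fun B : {set T} => inord #|B| : 'I_#|A|.+1) (fun i => 0 < i)) /=.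
  rewrite big_add1 big_mkord [LHS]big_mkcond big_ord_recl /= add0n.
  apply: eq_bigr => i _; rewrite -cards_draws -sum_nat_const.
  apply: eq_big => [B|B]; last first.
    move=> /andP[/andP[sBA _] /eqP/(congr1 val)].
    by rewrite /= inordK ?ltnS ?subset_leq_card // => ->.
  rewrite inE; have [sBA|//] := boolP (B \subset A).
  rewrite -[_ == lift _ _]val_eqE /= inordK ?ltnS ?subset_leq_card //= -card_gt0.
  by rewrite /bump /= add1n; lia.
by move=> B /andP[sBA B0]; rewrite inordK ?ltnS ?subset_leq_card ?card_gt0.
Qed.

Local Open Scope ring_scope.

(** * Leading 2-adic digits *)

Lemma pchar2_F2 : 2%N \in [pchar 'F_2].
Proof. exact: pchar_Fp. Qed.

Lemma natr_F2 n : n%:R = (odd n)%:R :> 'F_2.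
Proof. by rewrite -modn2 (GRing.natr_mod_pchar pchar2_F2). Qed.

(** The residue mod 2 of [x / 2 ^ e]: [b = 1] means valuation exactly [e], while [b = 0] allows any
    larger valuation and [x = 0]. In this form it passes through sums and products. *)
Definition digit2 (e x : nat) (b : 'F_2) : Prop :=
  exists2 q, x = (q * 2 ^ e)%N & q%:R = b.

Lemma digit2M e f x y b d :
  digit2 e x b -> digit2 f y d -> digit2 (e + f) (x * y) (b * d).
Proof.
move=> [q -> <-] [r -> <-]; exists (q * r)%N; last by rewrite natrM.
by rewrite expnD mulnACA.
Qed.

Lemma digit2_sum (I : Type) (s : seq I) (P : pred I) e (F : I -> nat) (B : I -> 'F_2) :
    (forall i, P i -> digit2 e (F i) (B i)) ->
  digit2 e (\sum_(i <- s | P i) F i)%N (\sum_(i <- s | P i) B i).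
Proof.
move=> FB; apply: (big_ind2 (fun x b => digit2 e x b)) => //; first by exists 0%N.
by move=> x b y d [q -> <-] [r -> <-]; exists (q + r)%N; rewrite ?mulnDl ?natrD.
Qed.

Lemma digit2_logn e x :
  (0 < x)%N -> (e <= logn 2 x)%N -> digit2 e x (logn 2 x == e)%:R.
Proof.
move=> x_gt0; rewrite -pfactor_dvdn // => /dvdnP[q def_x]; exists q => //.
have q_gt0 : (0 < q)%N by case: q def_x x_gt0 => // ->.
rewrite def_x lognM ?expn_gt0 // pfactorK // natr_F2; congr (_ %:R); congr nat_of_bool.
by rewrite -{2}[e]add0n eqn_add2r -leqn0 leqNgt logn_gt0 mem_primes q_gt0 dvdn2 /= negbK.
Qed.

Lemma digit2_gt0 e x : digit2 e x 1 -> (0 < x)%N.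
Proof. by move=> [[|q] -> // _]; rewrite muln_gt0 expn_gt0. Qed.

Lemma logn_digit2 e x : digit2 e x 1 -> logn 2 x = e.
Proof.
move=> [q -> ]; rewrite natr_F2; case: (boolP (odd q)) => // odd_q _.
have q_gt0 : (0 < q)%N by case: q odd_q.
by rewrite lognM ?expn_gt0 // pfactorK // logn_coprime ?coprime2n.
Qed.

(** * Powers of the lacunary polynomial over F_2 *)

(* The reduction mod 2 of (e^(2x) - 1) / 2, truncated at degree 2 ^ l. *)
Definition lacunary l : {poly 'F_2} := \sum_(j < l) 'X^(2 ^ j).

(** Digit sum 1 characterizes the powers of 2. In the induction, an odd [i] can only match [2 ^ 0],
    and an even [i] is halved. *)
Lemma coef_lacunary l i : (i < 2 ^ l)%N -> (lacunary l)`_i = (s2 i == 1%N)%:R.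
Proof.
rewrite coef_sum; under eq_bigr do rewrite coefXn.
elim: l i => [|l IH] i lt_i.
  by rewrite big_ord0 (_ : i = 0%N) /s2 ?big_ord0 //; lia.
have lt_i2 : (i./2 < 2 ^ l)%N by rewrite expnS in lt_i; lia.
rewrite big_ord_recl /= s2_half; have [odd_i|even_i] := boolP (odd i).
  rewrite big1 ?addr0 => [|j _]; last first.
    by rewrite expnS; case: eqP => // def_i; move: odd_i; rewrite def_i oddM.
  by rewrite add1n eqSS s2_eq0; congr (nat_of_bool _)%:R; lia.
rewrite (_ : (i == 2 ^ 0)%N = false); last by apply: contraNF even_i => /eqP->.
rewrite add0r add0n -IH //; apply: eq_bigr => j _.
by rewrite expnS; congr (nat_of_bool _)%:R; lia.
Qed.

Lemma pchar2_polyF2 : 2%N \in [pchar {poly 'F_2}].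
Proof. by rewrite pchar_poly pchar2_F2. Qed.

(** Frobenius is additive, so squaring shifts every exponent [2 ^ j] to the next one; ['X^(2 ^ l)]
    is the truncation error. *)
Lemma lacunary_sqr l : lacunary l ^+ 2 = lacunary l + 'X + 'X^(2 ^ l).
Proof.
have telescope : lacunary l + 'X^(2 ^ l) = 'X + \sum_(j < l) 'X^(2 ^ j.+1).
  have -> : lacunary l + 'X^(2 ^ l) = lacunary l.+1 by rewrite /lacunary big_ord_recr.
  by rewrite /lacunary big_ord_recl expr1.
rewrite addrAC telescope addrAC (addrr_pchar2 pchar2_polyF2) add0r.
rewrite -(pFrobenius_autE pchar2_polyF2) rmorph_sum /=.
by apply: eq_bigr => j _; rewrite pFrobenius_autE -exprM mulnC -expnS.
Qed.

(** The polynomial is ['X] times a factor with constant term 1. *)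
Lemma coef_lacunaryX_diag l n : (lacunary l.+1 ^+ n)`_n = 1.
Proof.
have -> : lacunary l.+1 = 'X * (1 + 'X * \sum_(j < l) 'X^((2 ^ j.+1) - 2)).
  rewrite mulrDr mulr1 mulrA mulr_sumr /lacunary big_ord_recl expr1; congr (_ + _).
  apply: eq_bigr => j _; rewrite -expr2 -exprD subnKC //.
  by rewrite expnS -{1}[2%N]muln1 leq_mul ?expn_gt0.
rewrite exprMn coefXnM ltnn subnn -horner_coef0 horner_exp.
by rewrite hornerD hornerM hornerX mul0r addr0 hornerC expr1n.
Qed.

(* Since g ^ 2 = g + x, the coefficients of the powers of g satisfy Pascal's rule. *)
Lemma coef_lacunaryX l n k : (n < 2 ^ l.+1)%N -> (0 < k)%N -> (k <= n)%N ->
  (lacunary l.+1 ^+ k)`_n = 'C(n.*2 - k, n)%:R.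
Proof.
elim: n k => [|n IHn] k lt_n k_gt0 le_kn; first lia.
have [d def_k] : exists d, (k + d = n.+1)%N by exists (n.+1 - k)%N; lia.
(* Descent on [k] from the diagonal [k = n.+1]. *)
elim: d k k_gt0 le_kn def_k => [|d IHd] k k_gt0 le_kn def_k.
  rewrite addn0 in def_k; rewrite def_k coef_lacunaryX_diag.
  by rewrite (_ : (_ - _)%N = n.+1) ?binn //; lia.
(* Multiply the formula for [g ^ 2] by [g ^ (k - 1)]; the truncation term only affects degrees
   beyond [n.+1]. *)
have -> : (lacunary l.+1 ^+ k)`_n.+1 =
    (lacunary l.+1 ^+ k.+1)`_n.+1 + (lacunary l.+1 ^+ k.-1)`_n.
  case: k k_gt0 {IHd le_kn def_k} => // k _.
  rewrite [in RHS]exprSr exprSr -mulrA -expr2 lacunary_sqr !mulrDr !coefD.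
  rewrite coefMX coefMXn lt_n addr0 /= -addrA.
  by rewrite (addrr_pchar2 pchar2_F2) addr0.
rewrite IHd //; [|lia..].
case: k k_gt0 le_kn def_k {IHd} => // k _ le_kn def_k /=.
rewrite (_ : (n.+1.*2 - k.+1 = (n.*2 - k).+1)%N); last lia.
rewrite (_ : (n.+1.*2 - k.+2 = n.*2 - k)%N); last lia.
rewrite binS natrD; congr (_ + _).
(* Exponent 0 lies outside [IHn]: there the coefficient vanishes for positive [n], and the central
   binomial is even, being a sum of two equal terms. *)
case: k le_kn def_k => [|k] le_kn def_k; last by rewrite IHn //; lia.
rewrite expr0 coefC subn0; case: n {IHn lt_n le_kn} def_k => [|n] def_k //=.
rewrite binS -(@bin_sub n.*2.+1 n); last by lia.
by rewrite (_ : (n.*2.+1 - n)%N = n.+1) ?natrD ?(addrr_pchar2 pchar2_F2) //; lia.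
Qed.

(** * Valuations of surjection and Stirling numbers *)

(** Replaces the exponential series: the recurrence of [surj] is matched term by term with the
    convolution for [g * g ^ k]. The term of degree 0 vanishes, as fibres are nonempty. *)
Lemma digit2_surj l n k : (n < 2 ^ l)%N ->
  digit2 (k + logn 2 n`!) (2 ^ n * surj n k) ((lacunary l ^+ k)`_n).
Proof.
elim: k n => [|k IHk] n lt_n /=.
  rewrite expr0 coefC; case: n lt_n => [|n] _ /=; first by exists 1%N.
  by exists 0%N; rewrite ?muln0.
rewrite exprS coefM big_ord_recl coef_lacunary ?expn_gt0 // /s2 big_ord0 mul0r add0r.
rewrite big_add1 big_mkord big_distrr /=; apply: digit2_sum => i _.
set j := bump 0 i; have j_gt0 : (0 < j)%N by [].
have le_jn : (j <= n)%N by have := ltn_ord i; rewrite /j /bump; lia.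
have -> : (2 ^ n * ('C(n, i.+1) * surj (n - i.+1) k) =
    (2 ^ j * 'C(n, j)) * (2 ^ (n - j) * surj (n - j) k))%N.
  by rewrite -{1}(subnKC le_jn) expnD mulnACA.
have logF : (logn 2 n`! = logn 2 'C(n, j) + logn 2 j`! + logn 2 (n - j)`!)%N.
  by rewrite -(bin_fact le_jn) !lognM ?muln_gt0 ?bin_gt0 ?fact_gt0 // addnA.
have := logn2_factD j; move: (s2_eq0 j); rewrite (gtn_eqF j_gt0) => s2j legendre.
(* By Legendre the excess over the expected exponent is [s2 j - 1], so the digit is 1 exactly when
   [j] is a power of 2. *)
have logP : logn 2 (2 ^ j * 'C(n, j)) = (s2 j + (logn 2 n`! - logn 2 (n - j)`!))%N.
  by rewrite lognM ?expn_gt0 ?bin_gt0 // pfactorK //; lia.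
rewrite (_ : k.+1 + _ = (1 + (logn 2 n`! - logn 2 (n - j)`!)) + (k + logn 2 (n - j)`!))%N;
  last lia.
apply: digit2M; last by apply: IHk; apply: leq_ltn_trans lt_n; apply: leq_subr.
rewrite coef_lacunary ?(leq_ltn_trans le_jn) //.
have := @digit2_logn (1 + (logn 2 n`! - logn 2 (n - j)`!)) (2 ^ j * 'C(n, j)).
rewrite logP eqn_add2r; apply; first by rewrite muln_gt0 expn_gt0 bin_gt0.
by rewrite leq_add2r lt0n s2j.
Qed.

Local Close Scope ring_scope.

(** By Legendre the valuation is [s2 N + s2 m - s2 (N + m)], which is 0 because the bits of [N] and
    [m] are disjoint. *)
Lemma odd_bin_shift c m n : 0 < c -> m < 2 ^ n -> odd 'C(c * 2 ^ n + m, c * 2 ^ n).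
Proof.
move=> c_gt0 lt_m; set N := c * 2 ^ n.
have C_gt0 : 0 < 'C(N + m, N) by rewrite bin_gt0 leq_addr.
suff: logn 2 'C(N + m, N) = 0.
  by move/eqP; rewrite -leqn0 leqNgt logn_gt0 mem_primes C_gt0 dvdn2 /= negbK.
have := congr1 (logn 2) (bin_fact (leq_addr m N)).
rewrite addKn !lognM ?muln_gt0 ?fact_gt0 //.
have := s2_shiftD c lt_m; have := @s2_shiftD c 0 n (ltac:(by rewrite expn_gt0)).
have := logn2_factD N; have := logn2_factD m; have := logn2_factD (N + m).
by rewrite addn0 -/N (_ : s2 0 = 0) ?/s2 ?big_ord0 // -!/(s2 _); lia.
Qed.

Theorem theorem1p2 (a c n : nat) (hc1 : 1 <= c) (hc : odd c) (hn : 2 <= n)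
    (ha1 : 1 <= a) (ha2 : a <= 2 ^ n) :
  logn 2 (stirling2 (c * 2 ^ n) ((c - 1) * 2 ^ n + a)) = s2 a - 1.
Proof.
set N := c * 2 ^ n; set k := (c - 1) * 2 ^ n + a.
have defN : N = (c - 1) * 2 ^ n + 2 ^ n by rewrite -mulSnr -subSn // subn1.
have le_kN : k <= N by rewrite defN leq_add2l.
have s2_0 : s2 0 = 0 by rewrite /s2 big_ord0.
(* As [c] is odd, [c] and [c - 1] differ only in the last bit. *)
have s2N : s2 N = (s2 (c - 1)).+1.
  rewrite -[N]addn0 s2_shiftD ?expn_gt0 // s2_0 addn0 (s2_half c) (s2_half (c - 1)) hc.
  have -> : (c - 1)./2 = c./2 by lia.
  by have -> : odd (c - 1) = false by lia.
have s2k : s2 k = s2 (c - 1) + s2 a.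
  (* If [a = 2 ^ n], then [a] does not fit in the low [n] bits, but [k = N]. *)
  move: ha2; rewrite leq_eqVlt => /orP[/eqP a_eq|]; last exact: s2_shiftD.
  by rewrite /k a_eq -defN s2N s2_exp2 addn1.
have ltN : N < 2 ^ N.+1 by apply: ltn_trans (ltnSn _) (ltn_expl _ _).
have := digit2_surj k ltN.
rewrite coef_lacunaryX ?(leq_trans ha1) ?leq_addl //.
have -> : N.*2 - k = c * 2 ^ n + (2 ^ n - a) by rewrite -/N; lia.
rewrite natr_F2 odd_bin_shift //; last by lia.
have := card_kpartitions [set: 'I_N] k.
rewrite cardsT card_ord -[#|_|]/(stirling2 N k) => <- digitS.
(* A digit 1 forces the product, hence the Stirling number, to be nonzero, so [logn] splits over the
   factors. *)
have := digit2_gt0 digitS; rewrite !muln_gt0 => /and3P[_ _ S_gt0].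
move: digitS => /logn_digit2.
rewrite !lognM ?muln_gt0 ?fact_gt0 ?expn_gt0 ?S_gt0 // pfactorK //.
(* Legendre turns the equation into valuation [s2 k - s2 N]; [s2 a] is positive, so [s2 a - 1] is
   not truncated. *)
have := logn2_factD N; have := logn2_factD k; have := s2_eq0 a.
lia.
Qed.
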